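(* Let $A\in\mathcal{V}(I)$, let $\alpha:G\curvearrowright A$ be a generalized partial action of $G$ on the algebra $A$, and let the global action $\theta:G\curvearrowright\Omega(A)$ and the map $\nu:A\to\Omega(A)$ be as defined in the context. If $\alpha$ is globalizable (i.e. admits some globalization), then $(\theta,\nu)$ is a globalization of $\alpha$.
   Context: $K$ is an associative commutative unital ring, all modules, algebras and tensor products are over $K$, and $G$ is a group. A non-associative algebra is a $K$-module with a $K$-bilinear product, not necessarily associative or unital. $F(X)$ is the free non-associative (non-unital) $K$-algebra on a countable set; for $I\subseteq F(X)$, $\mathcal{V}(I)$ is the class of all non-associative algebras satisfying all identities $f=0$, $f\in I$. A generalized partial action $\alpha:G\curvearrowright A$ of $G$ on an algebra $A\in\mathcal{V}(I)$ consists of subalgebras $A_g\subseteq A$ and algebra isomorphisms $\alpha_g:A_{g^{-1}}\to A_g$ ($g\in G$) such that $A_1=A$, $\alpha_1=\mathrm{id}$; $\alpha_g(A_{g^{-1}}\cap A_{g^{-1}h})\subseteq A_g\cap A_h$; and $\alpha_g\alpha_h(x)=\alpha_{gh}(x)$ for $x\in A_{h^{-1}}\cap A_{h^{-1}g^{-1}}$. It is global if all $A_g=A$. A $G$-equivariant map from $\alpha:G\curvearrowright A$ to $\beta:G\curvearrowright B$ is an algebra homomorphism $\phi:A\to B$ with $\phi(A_g)\subseteq B_g$ and $\phi(\alpha_g(x))=\beta_g(\phi(x))$ for all $g\in G$, $x\in A_{g^{-1}}$; it is an isomorphism if bijective with $G$-equivariant inverse. The restriction $\beta|_C$ of a global action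 $\beta:G\curvearrowright B$ to a subalgebra $C\subseteq B$ is the generalized partial action with $C_g=C\cap\beta_g(C)$ and maps the restrictions of $\beta_g$ to $C_{g^{-1}}$. A globalization of $\alpha$ is a pair $(\theta,\nu)$, where $\theta:G\curvearrowright B$ is a global action on an algebra $B\in\mathcal{V}(I)$ and $\nu:A\to B$ is $G$-equivariant, such that $\alpha$ and $\theta|_{\operatorname{im}\nu}$ are isomorphic as generalized partial actions via $\nu$ and $\bigcup_{g\in G}\theta_g(\operatorname{im}\nu)$ generates $B$ as an algebra. $\Lambda(A)$ is the quotient of the $K$-module $KG\otimes A$ by the submodule generated by all $g\otimes\alpha_h(a)-gh\otimes a$ ($g,h\in G$, $a\in A_{h^{-1}}$); $\lfloor g,a\rfloor$ is the class of $g\otimes a$. Put $\Theta_g(\lfloor h,a\rfloor)=\lfloor gh,a\rfloor$ and $\iota(a)=\lfloor 1,a\rfloor$. For a $K$-module $M$, $F_I(M)\in\mathcal{V}(I)$ with linear map $j:M\to F_I(M)$ is the free algebra generated by $M$ in $\mathcal{V}(I)$: for each $B\in\mathcal{V}(I)$ and each linear map $\phi:M\to B$ there is a unique algebra homomorphism $\widehat\phi:F_I(M)\to B$ with $\widehat\phi\circ j=\phi$. Let $\widetilde\Theta:G\curvearrowright F_I(\Lambda(A))$ be the unique global action by algebra automorphisms with $\widetilde\Theta_g\circ j=j\circ\Theta_g$. Let $J$ be the ideal of $F_I(\Lambda(A))$ generated by all $j(\lfloor g,a\rfloor)j(\lfloor g,b\rfloor)-j(\lfloor g,ab\rfloor)$,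 $a,b\in A$, $g\in G$; it is $\widetilde\Theta$-invariant. Set $\Omega(A)=F_I(\Lambda(A))/J$ with projection $p$, let $\theta:G\curvearrowright\Omega(A)$ be the global action with $\theta_g\circ p=p\circ\widetilde\Theta_g$, and let $\nu=p\circ j\circ\iota:A\to\Omega(A)$ (a $G$-equivariant algebra homomorphism). *)

(* Defs.v *)
From HB Require Import structures.
From mathcomp Require Import all_boot all_algebra.
From mathcomp Require Import finmap.
From mathcomp.multinomials Require Import monalg.
From mathcomp Require Import boolp classical_sets functions.

Set Implicit Arguments.
Unset Strict Implicit.
Unset Printing Implicit Defensive.

Import GRing.Theory.
Local Open Scope ring_scope.
Local Open Scope quotient_scope.
Local Open Scope classical_set_scope.

Reserved Notation "x ** y" (at level 40, left associativity).

HB.mixin Record Lmodule_isNaAlgebra (K : comPzRingType) A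
    of GRing.Lmodule K A := {
  namul : A -> A -> A;
  namul_linearl : forall b, linear (fun a => namul a b);
  namul_linearr : forall a, linear (namul a)
}.

#[short(type="naAlgType")]
HB.structure Definition NaAlgebra (K : comPzRingType) :=
  { A of GRing.Lmodule K A & Lmodule_isNaAlgebra K A }.

Notation "x ** y" := (namul x y) : ring_scope.

Section Submodules.
Variables (K : comPzRingType) (V : lmodType K).

Definition is_submod (S : set V) : Prop :=
  S 0 /\ (forall (k : K) x y, S x -> S y -> S (k *: x + y)).

Record submodule := Submodule {
  submod_set :> V -> Prop;
  submodP : is_submod submod_set }.

Lemma smallest_submod (E : set V) : is_submod (smallest is_submod E).
Proof.
split=> [S [[S0 _] _] //|k x y Sx Sy S SP].
have [[_ Slin] _] := SP; apply: Slin; [exact: Sx | exact: Sy].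
Qed.

Definition submod_span (E : set V) : submodule := Submodule (smallest_submod E).

Definition submod_pred (S : submodule) : {pred V} := fun x => `[< S x >].

Lemma submod_pred_zmod (S : submodule) : zmod_closed (submod_pred S).
Proof.
have [S0 Slin] := submodP S; split=> [|x y]; rewrite !unfold_in.
  exact/asboolP.
move=> /asboolP Sx /asboolP Sy; apply/asboolP.
by rewrite -scaleN1r addrC; apply: Slin.
Qed.

HB.instance Definition _ (S : submodule) :=
  GRing.isZmodClosed.Build V (submod_pred S) (submod_pred_zmod S).

Definition quotmod (S : submodule) : Type := Quotient.quot (submod_pred S).

HB.instance Definition _ S := GRing.Zmodule.on (quotmod S).

Definition qproj (S : submodule) (x : V) : quotmod S :=
  \pi_(Quotient.quot (submod_pred S)) x.

Lemma qprojB S : zmod_morphism (qproj S).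
Proof. exact: raddfB. Qed.

Lemma qproj_eq S x y : (qproj S x = qproj S y) <-> S (x - y).
Proof.
split=> [/eqP|Sxy]; last apply/eqP.
  by rewrite -Quotient.idealrBE => /asboolP.
by rewrite -Quotient.idealrBE; apply/asboolP.
Qed.

Definition qrepr S (x : quotmod S) : V := repr (x : Quotient.quot (submod_pred S)).

Lemma qreprK S (x : quotmod S) : qproj S (qrepr x) = x.
Proof. exact: reprK. Qed.

Lemma qproj_surj S (x : quotmod S) : exists y, qproj S y = x.
Proof. by exists (qrepr x); apply: qreprK. Qed.

Lemma submodZ (S : submodule) k x : S x -> S (k *: x).
Proof.
by have [S0 Slin] := submodP S => Sx; rewrite -[_ *: _]addr0; apply: Slin.
Qed.

Lemma submodD (S : submodule) x y : S x -> S y -> S (x + y).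
Proof.
by have [_ Slin] := submodP S => Sx Sy; rewrite -[x]scale1r; apply: Slin.
Qed.

Definition qscale S (k : K) (x : quotmod S) : quotmod S :=
  qproj S (k *: qrepr x).

Lemma qscaleE S k x : qscale k (qproj S x) = qproj S (k *: x).
Proof.
apply/qproj_eq; rewrite -scalerBr; apply: submodZ; apply/qproj_eq.
exact: qreprK.
Qed.

Lemma qprojD S x y : qproj S (x + y) = qproj S x + qproj S y.
Proof. exact: (raddfD (\pi_(Quotient.quot (submod_pred S)))). Qed.

Lemma qscaleA S a b (v : quotmod S) : qscale a (qscale b v) = qscale (a * b) v.
Proof. by have [x <-] := qproj_surj v; rewrite !qscaleE scalerA. Qed.

Lemma qscale1 S : left_id 1 (@qscale S).
Proof. by move=> v; have [x <-] := qproj_surj v; rewrite !qscaleE scale1r. Qed.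

Lemma qscaleDr S : right_distributive (@qscale S) +%R.
Proof.
move=> k u v; have [x <-] := qproj_surj u; have [y <-] := qproj_surj v.
by rewrite -qprojD !qscaleE scalerDr qprojD.
Qed.

Lemma qscaleDl S (v : quotmod S) :
  {morph (@qscale S)^~ v : a b / a + b}.
Proof.
by move=> a b; have [x <-] := qproj_surj v; rewrite !qscaleE scalerDl qprojD.
Qed.

HB.instance Definition _ S := GRing.Zmodule_isLmodule.Build K (quotmod S)
  (@qscaleA S) (@qscale1 S) (@qscaleDr S) (@qscaleDl S).

Lemma qproj_linear S : linear (qproj S).
Proof. by move=> k x y; rewrite qprojD -qscaleE. Qed.

End Submodules.

Section Linear.
Variable K : comPzRingType.
Implicit Types U V W : lmodType K.

Lemma linear0' U V (f : U -> V) : linear f -> f 0 = 0.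
Proof.
move=> lf; have := lf 1 0 0; rewrite !scale1r addr0.
by move/(congr1 (fun x => x - f 0)); rewrite subrr addrK.
Qed.

Lemma linearD' U V (f : U -> V) : linear f -> {morph f : x y / x + y}.
Proof. by move=> lf x y; have := lf 1 x y; rewrite !scale1r. Qed.

Lemma linearZ' U V (f : U -> V) k x : linear f -> f (k *: x) = k *: f x.
Proof. by move=> lf; have := lf k x 0; rewrite (linear0' lf) !addr0. Qed.

Lemma linearB' U V (f : U -> V) : linear f -> {morph f : x y / x - y}.
Proof.
by move=> lf x y; rewrite (linearD' lf) -scaleN1r (linearZ' _ _ lf) scaleN1r.
Qed.

Lemma linear_comp' U V W (f : U -> V) (g : V -> W) :
  linear f -> linear g -> linear (g \o f).
Proof. by move=> lf lg k x y /=; rewrite lf lg. Qed.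

Lemma linear_sum' U V (f : U -> V) (T : Type) (r : seq T) (F : T -> U) :
  linear f -> f (\sum_(i <- r) F i) = \sum_(i <- r) f (F i).
Proof.
by move=> lf; apply: (big_morph f (linearD' lf) (linear0' lf)).
Qed.

Lemma preim_submod U V (f : U -> V) (S : set V) :
  linear f -> is_submod S -> is_submod (f @^-1` S).
Proof.
move=> lf [S0 Slin]; split; first by rewrite /= (linear0' lf).
by move=> k x y /= Sx Sy; rewrite lf; apply: Slin.
Qed.

Lemma submod0 U : is_submod [set (0 : U)].
Proof. by split=> [//|k x y /= -> ->]; rewrite scaler0 addr0. Qed.

Definition qlift U V (S : submodule U) (f : U -> V) (x : quotmod S) : V :=
  f (qrepr x).

Section Qlift.
Variables (U V : lmodType K) (S : submodule U) (f : U -> V).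
Hypotheses (lf : linear f) (fS : forall x, S x -> f x = 0).

Lemma qliftE x : qlift f (qproj S x) = f x.
Proof.
apply/eqP; rewrite -subr_eq0 -(linearB' lf); apply/eqP/fS/qproj_eq.
exact: qreprK.
Qed.

Lemma qlift_linear : linear (@qlift U V S f).
Proof.
move=> k x y; have [u <-] := qproj_surj x; have [v <-] := qproj_surj y.
by rewrite -qproj_linear !qliftE lf.
Qed.
End Qlift.

Lemma span_kill U V (E : set U) (f : U -> V) : linear f ->
  (forall x, E x -> f x = 0) -> forall x, submod_span E x -> f x = 0.
Proof.
move=> lf fE x Sx; have := Sx (f @^-1` [set 0]); apply; split=> //.
exact/(preim_submod lf)/submod0.
Qed.

Lemma mem_span U (E : set U) x : E x -> submod_span E x.
Proof. by move=> Ex S [_]; apply. Qed.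

Lemma qproj_span U (E : set U) x y :
  E (x - y) -> qproj (submod_span E) x = qproj (submod_span E) y.
Proof. by move=> Exy; apply/qproj_eq; apply: mem_span. Qed.

End Linear.

(* monalg equips {malg K[X]} with scaling only when K is nontrivial, whence *)
(* the alias.                                                               *)

Section FreeModuleScale.
Variables (K : comPzRingType) (X : choiceType).

Definition freemod : Type := {malg K[X]}.

HB.instance Definition _ := GRing.Zmodule.on freemod.

Definition fmscale (c : K) (u : freemod) : freemod :=
  \sum_(x <- msupp u) << c * mcoeff x u *g x >>.

Lemma fmscaleE c (u : freemod) x : mcoeff x (fmscale c u) = c * mcoeff x u.
Proof.
rewrite {2}[u]monalgE !raddf_sum mulr_sumr.
by apply/eq_bigr=> /= i _; rewrite !mcoeffU mulrnAr.
Qed.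

Lemma fmscaleA a b u : fmscale a (fmscale b u) = fmscale (a * b) u.
Proof. by apply/malgP=> x; rewrite !fmscaleE mulrA. Qed.

Lemma fmscale1 : left_id 1 fmscale.
Proof. by move=> u; apply/malgP=> x; rewrite !fmscaleE mul1r. Qed.

Lemma fmscaleDr : right_distributive fmscale +%R.
Proof.
by move=> c u v; apply/malgP=> x; rewrite !(mcoeffD, fmscaleE) mulrDr.
Qed.

Lemma fmscaleDl u : {morph fmscale^~ u : a b / a + b}.
Proof.
by move=> a b; apply/malgP=> x; rewrite !(mcoeffD, fmscaleE) mulrDl.
Qed.

HB.instance Definition _ := GRing.Zmodule_isLmodule.Build K freemod
  fmscaleA fmscale1 fmscaleDr fmscaleDl.

End FreeModuleScale.

HB.lock Definition fmgen (K : comPzRingType) (X : choiceType) (x : X) :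
  freemod K X := << 1 *g x >>.

HB.lock Definition fmlift (K : comPzRingType) (X : choiceType) (V : lmodType K)
    (f : X -> V) (u : freemod K X) : V :=
  \sum_(x <- msupp u) mcoeff x u *: f x.

Arguments fmgen K {X} x.
Arguments fmlift {K X V} f u.

Section FreeModule.
Variables (K : comPzRingType) (X : choiceType).
Local Notation freemod := (freemod K X).
Local Notation fmgen := (fmgen K).

Lemma fmcoeffZ c (u : freemod) x : mcoeff x (c *: u) = c * mcoeff x u.
Proof. exact: fmscaleE. Qed.

Lemma fmgenE c x : (<< c *g x >> : freemod) = c *: fmgen x.
Proof.
by apply/malgP=> y; rewrite fmgen.unlock fmcoeffZ !mcoeffU mulrnAr mulr1.
Qed.

Variable V : lmodType K.

Implicit Types f : X -> V.

Lemma fmliftEw f (u : freemod) (d : {fset X}) : fsubset (msupp u) d ->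
  fmlift f u = \sum_(x <- d) mcoeff x u *: f x.
Proof.
rewrite fmlift.unlock => sud; apply: big_fset_incl => // x _ /mcoeff_outdom ->.
by rewrite scale0r.
Qed.

Lemma fmlift_linear f : linear (fmlift f).
Proof.
move=> k u v.
pose d := fsetU (msupp (k *: u + v)) (fsetU (msupp u) (msupp v)).
rewrite (@fmliftEw _ _ d) ?fsubsetUl //.
rewrite (@fmliftEw _ u d); last first.
  by apply: fsubset_trans (fsubsetUr _ _); apply: fsubsetUl.
rewrite (@fmliftEw _ v d); last first.
  by apply: fsubset_trans (fsubsetUr _ _); apply: fsubsetUr.
rewrite scaler_sumr -big_split; apply: eq_bigr => x _ /=.
by rewrite mcoeffD fmcoeffZ scalerDl scalerA.
Qed.

Lemma fmliftE f x : fmlift f (fmgen x) = f x.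
Proof.
rewrite (@fmliftEw _ _ [fset x]%fset) fmgen.unlock ?msuppU_le // big_seq_fset1.
by rewrite mcoeffUU scale1r.
Qed.

Lemma fmlift_param_linear (W : lmodType K) (F : X -> W -> V) (u : freemod) :
  (forall x, linear (F x)) -> linear (fun w => fmlift (fun x => F x w) u).
Proof.
move=> lF k v w; rewrite fmlift.unlock scaler_sumr -big_split.
by apply: eq_bigr => x _; rewrite lF scalerDr !scalerA mulrC.
Qed.

Lemma freemod_ext (f g : freemod -> V) : linear f -> linear g ->
  (forall x, f (fmgen x) = g (fmgen x)) -> f = g.
Proof.
move=> lf lg fg; apply/funext => u; rewrite [u]monalgE.
rewrite (linear_sum' _ _ lf) (linear_sum' _ _ lg); apply: eq_bigr => x _.
by rewrite fmgenE (linearZ' _ _ lf) (linearZ' _ _ lg) fg.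
Qed.

End FreeModule.

Section Tensor.
Variables (K : comPzRingType) (M N : lmodType K).

Let ten (m : M) (n : N) : freemod K (M * N)%type := fmgen K (m, n).

Definition tensor_rel : set (freemod K (M * N)%type) :=
  [set r | (exists (k : K) (m m' : M) (n : N),
              r = ten (k *: m + m') n - (k *: ten m n + ten m' n)) \/
           (exists (k : K) (m : M) (n n' : N),
              r = ten m (k *: n + n') - (k *: ten m n + ten m n'))].

Definition tensor : lmodType K := quotmod (submod_span tensor_rel).

Definition tens (m : M) (n : N) : tensor := qproj (submod_span tensor_rel) (ten m n).

Lemma tens_linearl n : linear (fun m => tens m n).
Proof.
move=> k m m'; rewrite -(qproj_linear (submod_span tensor_rel)).
by apply: qproj_span; rewrite /tensor_rel /=; left; exists k, m, m', n.
Qed.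

Lemma tens_linearr m : linear (tens m).
Proof.
move=> k n n'; rewrite -(qproj_linear (submod_span tensor_rel)).
by apply: qproj_span; rewrite /tensor_rel /=; right; exists k, m, n, n'.
Qed.

Section Lift.
Variables (V : lmodType K) (f : M -> N -> V).

Definition tlift : tensor -> V :=
  qlift (S := submod_span tensor_rel) (fmlift (fun z => f z.1 z.2)).

Hypotheses (fl : forall n, linear (fun m => f m n)) (fr : forall m, linear (f m)).

Lemma tlift_kill x : submod_span tensor_rel x -> fmlift (fun z => f z.1 z.2) x = 0.
Proof.
have L := @fmlift_linear K _ V (fun z : M * N => f z.1 z.2).
apply: (span_kill L) => {x} _ [[k [m [m' [n ->]]]]|[k [m [n [n' ->]]]]].
  by rewrite (linearB' L) L !fmliftE /= fl subrr.
by rewrite (linearB' L) L !fmliftE /= fr subrr.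
Qed.

Lemma tlift_linear : linear tlift.
Proof. exact: (qlift_linear (@fmlift_linear _ _ _ _) tlift_kill). Qed.

Lemma tliftE m n : tlift (tens m n) = f m n.
Proof.
by rewrite /tlift (qliftE (@fmlift_linear _ _ _ _) tlift_kill) fmliftE.
Qed.
End Lift.

Lemma tensor_ext (V : lmodType K) (f g : tensor -> V) : linear f -> linear g ->
  (forall m n, f (tens m n) = g (tens m n)) -> f = g.
Proof.
move=> lf lg fg; apply/funext => t; have [u <-] := qproj_surj t.
have : f \o qproj (submod_span tensor_rel) = g \o qproj (submod_span tensor_rel).
  apply: freemod_ext => [||[m n]]; try exact/linear_comp'/lf/qproj_linear.
    exact/linear_comp'/lg/qproj_linear.
  exact: fg.
by move/(congr1 (@^~ u)).
Qed.

End Tensor.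

Section Algebras.
Variable K : comPzRingType.

Definition alg_hom (A B : naAlgType K) (f : A -> B) : Prop :=
  linear f /\ {morph f : x y / x ** y}.

Lemma alg_hom_comp (A B C : naAlgType K) (f : A -> B) (g : B -> C) :
  alg_hom f -> alg_hom g -> alg_hom (g \o f).
Proof.
move=> [lf mf] [lg mg]; split; first exact: linear_comp'.
by move=> x y /=; rewrite mf mg.
Qed.

Lemma alg_hom_id (A : naAlgType K) : alg_hom (fun x : A => x).
Proof. by []. Qed.

Section OneAlgebra.
Variable A : naAlgType K.

Lemma namulBl (x y z : A) : (x - y) ** z = x ** z - y ** z.
Proof. exact: (linearB' (namul_linearl z)). Qed.

Lemma namulBr (x y z : A) : x ** (y - z) = x ** y - x ** z.
Proof. exact: (linearB' (namul_linearr x)). Qed.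

Definition is_subalg (S : set A) : Prop :=
  is_submod S /\ (forall x y, S x -> S y -> S (x ** y)).

Record subalg := Subalg {
  subalg_set :> A -> Prop;
  subalgP : is_subalg subalg_set }.

Definition gen_subalg (E : set A) : set A := smallest is_subalg E.

Definition is_ideal (J : set A) : Prop :=
  is_submod J /\ (forall a x, J x -> J (a ** x) /\ J (x ** a)).

Record ideal := Ideal {
  ideal_set :> A -> Prop;
  idealP : is_ideal ideal_set }.

Lemma smallest_ideal (E : set A) : is_ideal (smallest is_ideal E).
Proof.
split; first split.
- by move=> J [[[]]].
- move=> k x y Jx Jy J JP; have [[[_ Jlin] _] _] := JP.
  by apply: Jlin; [exact: Jx | exact: Jy].
- move=> a x Jx; split=> J JP; have [[_ Jm] _] := JP.
    by apply: (Jm a x _).1; exact: Jx.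
  by apply: (Jm a x _).2; exact: Jx.
Qed.

Definition gen_ideal (E : set A) : ideal := Ideal (smallest_ideal E).

Lemma mem_gen_ideal (E : set A) x : E x -> gen_ideal E x.
Proof. by move=> Ex J [_]; apply. Qed.

Definition ideal_submod (J : ideal) : submodule A := Submodule (idealP J).1.

Definition quotalg (J : ideal) : Type := quotmod (ideal_submod J).

HB.instance Definition _ J := GRing.Lmodule.on (quotalg J).

Definition aproj (J : ideal) (x : A) : quotalg J := qproj (ideal_submod J) x.

Lemma aproj_gen (E : set A) x y :
  E (x - y) -> aproj (gen_ideal E) x = aproj (gen_ideal E) y.
Proof.
move=> Exy; apply/(qproj_eq (ideal_submod (gen_ideal E))).
exact: mem_gen_ideal.
Qed.

Definition qmul J (x y : quotalg J) : quotalg J :=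
  aproj J (qrepr x ** qrepr y).

Lemma qmulE J x y : qmul (aproj J x) (aproj J y) = aproj J (x ** y).
Proof.
apply/qproj_eq.
set x' := qrepr _; set y' := qrepr _.
have -> : x' ** y' - x ** y = (x' - x) ** y' + x ** (y' - y).
  by rewrite namulBl namulBr addrA subrK.
apply: submodD.
  by apply: ((idealP J).2 _ _ _).2; apply/(qproj_eq (ideal_submod J))/qreprK.
by apply: ((idealP J).2 _ _ _).1; apply/(qproj_eq (ideal_submod J))/qreprK.
Qed.

Lemma qmul_linearl J (b : quotalg J) : linear (fun a => qmul a b).
Proof.
move=> k u v; have [x <-] := qproj_surj u; have [y <-] := qproj_surj v.
have [z <-] := qproj_surj b; rewrite -qproj_linear !qmulE namul_linearl.
exact: qproj_linear.
Qed.

Lemma qmul_linearr J (a : quotalg J) : linear (qmul a).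
Proof.
move=> k u v; have [x <-] := qproj_surj u; have [y <-] := qproj_surj v.
have [z <-] := qproj_surj a; rewrite -qproj_linear !qmulE namul_linearr.
exact: qproj_linear.
Qed.

HB.instance Definition _ J := Lmodule_isNaAlgebra.Build K (quotalg J)
  (@qmul_linearl J) (@qmul_linearr J).

Lemma aproj_hom J : alg_hom (aproj J).
Proof. by split=> [|x y]; [apply: qproj_linear | rewrite -qmulE]. Qed.

Definition alift (B : lmodType K) (J : ideal) (f : A -> B) : quotalg J -> B :=
  qlift (S := ideal_submod J) f.

Lemma gen_ideal_kill (B : naAlgType K) (E : set A) (f : A -> B) : alg_hom f ->
  (forall x, E x -> f x = 0) -> forall x, gen_ideal E x -> f x = 0.
Proof.
move=> [lf mf] fE x Jx; have := Jx (f @^-1` [set 0]); apply; split=> //.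
split; first exact/(preim_submod lf)/submod0.
move=> a y /= fy; rewrite !mf fy; split.
  exact: linear0' (namul_linearr _).
exact: (linear0' (namul_linearl _)).
Qed.

Lemma alift_hom (B : naAlgType K) (J : ideal) (f : A -> B) : alg_hom f ->
  (forall x, J x -> f x = 0) -> alg_hom (alift (J := J) f).
Proof.
move=> [lf mf] fJ; split; first exact: (qlift_linear (S := ideal_submod J)).
move=> u v; have [x <-] := qproj_surj u; have [y <-] := qproj_surj v.
rewrite -[_ ** _]/(qmul (aproj J x) (aproj J y)) qmulE.
by rewrite /alift !(qliftE (S := ideal_submod J) lf fJ) mf.
Qed.

Lemma aliftE (B : lmodType K) (J : ideal) (f : A -> B) : linear f ->
  (forall x, J x -> f x = 0) -> forall x, alift f (aproj J x) = f x.
Proof. by move=> lf fJ x; apply: (qliftE (S := ideal_submod J)). Qed.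

Definition subalg_type (S : subalg) : Type :=
  {x : A | x \in (subalg_set S : set A)}.

Section SubalgType.
Variable S : subalg.

HB.instance Definition _ := [isSub of subalg_type S for sval].
HB.instance Definition _ := [Choice of subalg_type S by <:].

Lemma subalg_subsemimod :
  subsemimod_closed (fun x : A => x \in (subalg_set S : set A)).
Proof.
have [[S0 Slin] _] := subalgP S.
split; first split.
- exact/mem_set.
- move=> x y /set_mem Sx /set_mem Sy; apply/mem_set.
  by rewrite -[x]scale1r; apply: Slin.
- move=> k x /set_mem Sx; apply/mem_set.
  by rewrite -[_ *: _]addr0; apply: Slin.
Qed.

HB.instance Definition _ := GRing.SubChoice_isSubLmodule.Build K A
  (fun x : A => x \in (subalg_set S : set A)) (subalg_type S) subalg_subsemimod.

Lemma submul_proof (x y : subalg_type S) :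
  (sval x ** sval y) \in (subalg_set S : set A).
Proof.
apply: mem_set; apply: (subalgP S).2.
  exact: set_mem (svalP x).
exact: set_mem (svalP y).
Qed.

Definition submul (x y : subalg_type S) : subalg_type S :=
  exist _ (sval x ** sval y) (submul_proof x y).

Lemma submul_linearl b : linear (fun a => submul a b).
Proof. by move=> k x y; apply: val_inj; rewrite /= namul_linearl. Qed.

Lemma submul_linearr a : linear (submul a).
Proof. by move=> k x y; apply: val_inj; rewrite /= namul_linearr. Qed.

HB.instance Definition _ := Lmodule_isNaAlgebra.Build K (subalg_type S)
  submul_linearl submul_linearr.

Lemma val_hom : alg_hom (fun x : subalg_type S => sval x).
Proof. by split. Qed.

End SubalgType.
End OneAlgebra.

Lemma subalgT (A : naAlgType K) : is_subalg [set: A].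
Proof. by split; first split. Qed.

Lemma im_subalg_proof (A B : naAlgType K) (f : A -> B) :
  alg_hom f -> is_subalg (range f).
Proof.
move=> [lf mf]; split; first split.
- by exists 0 => //; apply: linear0'.
- by move=> k _ _ [x _ <-] [y _ <-]; exists (k *: x + y); rewrite ?lf.
- by move=> _ _ [x _ <-] [y _ <-]; exists (x ** y); rewrite ?mf.
Qed.

Definition im_subalg (A B : naAlgType K) (f : A -> B) (hf : alg_hom f) :
  subalg B := Subalg (im_subalg_proof hf).

Definition corestr (A B : naAlgType K) (f : A -> B) (hf : alg_hom f) (x : A) :
  subalg_type (im_subalg hf) :=
  exist _ (f x) (mem_set (imageT f x)).

End Algebras.

Inductive fmagma (X : Type) : Type :=
  | MVar of X
  | MMul of fmagma X & fmagma X.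

Fixpoint fmagma_tree (X : Type) (t : fmagma X) : GenTree.tree X :=
  match t with
  | MVar x => GenTree.Leaf x
  | MMul t u => GenTree.Node 0 [:: fmagma_tree t; fmagma_tree u]
  end.

Fixpoint tree_fmagma (X : Type) (t : GenTree.tree X) : option (fmagma X) :=
  match t with
  | GenTree.Leaf x => Some (MVar x)
  | GenTree.Node _ [:: t; u] =>
      if tree_fmagma t is Some t' then
        if tree_fmagma u is Some u' then Some (MMul t' u') else None
      else None
  | _ => None
  end.

Lemma fmagma_treeK (X : Type) : pcancel (@fmagma_tree X) (@tree_fmagma X).
Proof. by elim=> //= t -> u ->. Qed.

HB.instance Definition _ (X : choiceType) :=
  Choice.copy (fmagma X) (pcan_type (@fmagma_treeK X)).

Section FreeAlgebra.
Variables (K : comPzRingType) (X : choiceType).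

Definition freealg : Type := freemod K (fmagma X).

HB.instance Definition _ := GRing.Lmodule.on freealg.

(* The bilinear extension of the product of the free magma. *)
Definition famul (u v : freealg) : freealg :=
  fmlift (fun s => fmlift (fun t => fmgen K (MMul s t) : freealg) v) u.

Lemma famul_linearl v : linear (fun u => famul u v).
Proof. exact: fmlift_linear. Qed.

Lemma famul_linearr u : linear (famul u).
Proof.
by apply: fmlift_param_linear => s; apply: fmlift_linear.
Qed.

HB.instance Definition _ := Lmodule_isNaAlgebra.Build K freealg
  famul_linearl famul_linearr.

Definition fagen (t : fmagma X) : freealg := fmgen K t.

Definition favar (x : X) : freealg := fagen (MVar x).

Lemma fagenM s t : fagen s ** fagen t = fagen (MMul s t).
Proof.
transitivity (famul (fagen s) (fagen t)); first by [].
by rewrite /famul /fagen !fmliftE.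
Qed.

Lemma freealg_ext (V : lmodType K) (f g : freealg -> V) :
  linear f -> linear g -> (forall t, f (fagen t) = g (fagen t)) -> f = g.
Proof. exact: freemod_ext. Qed.

Variable B : naAlgType K.

Fixpoint fmagma_eval (v : X -> B) (t : fmagma X) : B :=
  match t with
  | MVar x => v x
  | MMul t u => fmagma_eval v t ** fmagma_eval v u
  end.

Definition faeval (v : X -> B) : freealg -> B := fmlift (fmagma_eval v).

Lemma faeval_linear v : linear (faeval v).
Proof. exact: fmlift_linear. Qed.

Lemma faeval_gen v t : faeval v (fagen t) = fmagma_eval v t.
Proof. exact: fmliftE. Qed.

Lemma faeval_hom v : alg_hom (faeval v).
Proof.
split=> [|f g]; first exact: faeval_linear.
have H s h : faeval v (fagen s ** h) = fmagma_eval v s ** faeval v h.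
  have lr := linear_comp' (@namul_linearr K freealg (fagen s)) (faeval_linear v).
  have ll := linear_comp' (faeval_linear v) (namul_linearr (fmagma_eval v s)).
  apply: (congr1 (@^~ h) (freealg_ext lr ll _)) => t /=.
  by rewrite fagenM !faeval_gen.
have lr := linear_comp' (@namul_linearl K freealg g) (faeval_linear v).
have ll := linear_comp' (faeval_linear v) (namul_linearl (faeval v g)).
apply: (congr1 (@^~ f) (freealg_ext lr ll _)) => s /=.
by rewrite H faeval_gen.
Qed.

Lemma faevalE v x : faeval v (favar x) = v x.
Proof. exact: faeval_gen. Qed.

Lemma faeval_uniq v (f : freealg -> B) : alg_hom f ->
  (forall x, f (favar x) = v x) -> f = faeval v.
Proof.
move=> [lf mf] fv; apply: freealg_ext => //; first exact: faeval_linear.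
elim=> [x|s IHs t IHt]; first by rewrite fv faevalE.
by rewrite -fagenM mf (faeval_hom v).2 IHs IHt.
Qed.

End FreeAlgebra.

Section Variety.
Variables (K : comPzRingType) (I : set (freealg K nat)).

(* [faeval v] is the homomorphism F(X) -> B extending v : X -> B, with      *)
(* X = nat.                                                                 *)
Definition in_variety (B : naAlgType K) : Prop :=
  forall (v : nat -> B) f, I f -> faeval v f = 0.

(* The universal property determines F_I(M) up to isomorphism; a model is   *)
(* constructed in free_in_variety_exists.                                   *)
Record free_in_variety (M : lmodType K) := FreeInVariety {
  fiv_alg :> naAlgType K;
  fiv_variety : in_variety fiv_alg;
  fiv_j : M -> fiv_alg;
  fiv_j_linear : linear fiv_j;
  fiv_universal : forall B : naAlgType K, in_variety B ->
    forall phi : M -> B, linear phi ->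
    exists! psi : fiv_alg -> B, alg_hom psi /\ psi \o fiv_j = phi }.

Arguments fiv_variety {M} f _ _ _ : rename.
Arguments fiv_j_linear {M} f _ _ _ : rename.

Lemma faeval_comp (A B : naAlgType K) (h : A -> B) (v : nat -> A) :
  alg_hom h -> h \o faeval v = faeval (h \o v).
Proof.
move=> hh; apply: faeval_uniq => [|x /=]; last by rewrite faevalE.
exact: alg_hom_comp (faeval_hom v) hh.
Qed.

Lemma quotalg_variety (A : naAlgType K) (J : ideal A) :
  (forall (v : nat -> A) f, I f -> J (faeval v f)) -> in_variety (quotalg J).
Proof.
move=> JI v f If; pose w n : A := qrepr (v n).
have -> : v = aproj J \o w by apply/funext => n /=; rewrite /aproj qreprK.
rewrite -(faeval_comp w (aproj_hom J)) /= -(linear0' (aproj_hom J).1).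
by apply/qproj_eq; rewrite subr0; apply: JI.
Qed.

Section Existence.
Variable M : lmodType K.

Let X (m : M) : freealg K M := @favar K M m.

Definition fiv_rel : set (freealg K M) :=
  [set r | (exists (k : K) (m m' : M), r = X (k *: m + m') - (k *: X m + X m')) \/
           (exists (v : nat -> freealg K M) f, I f /\ r = faeval v f)].

Lemma fiv_rel_kill (B : naAlgType K) (phi : M -> B) : in_variety B ->
  linear phi -> forall x, gen_ideal fiv_rel x -> faeval phi x = 0.
Proof.
move=> VB lphi; have hphi := faeval_hom phi; have [L _] := hphi.
have XE m : faeval phi (X m) = phi m by apply: faevalE.
apply: (gen_ideal_kill hphi) => _ [[k [m [m' ->]]]|[v [f [If ->]]]].
  by rewrite (linearB' L) L !XE lphi subrr.
by rewrite -[LHS]/((faeval phi \o faeval v) f) (faeval_comp v hphi) VB.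
Qed.

Lemma free_in_variety_exists : inhabited (free_in_variety M).
Proof.
pose F : naAlgType K := quotalg (gen_ideal fiv_rel).
pose j m : F := aproj (gen_ideal fiv_rel) (X m).
have [pl pm] := aproj_hom (gen_ideal fiv_rel).
have VF : in_variety F.
  apply: quotalg_variety => v f If; apply: mem_gen_ideal; rewrite /fiv_rel /=.
  by right; exists v, f.
have jl : linear j.
  move=> k m m'; rewrite -pl; apply: aproj_gen.
  by rewrite /fiv_rel /=; left; exists k, m, m'.
constructor; apply: (FreeInVariety VF jl) => B VB phi lphi.
have kill := fiv_rel_kill VB lphi.
have hphi := faeval_hom phi.
have hl : alg_hom (alift (J := gen_ideal fiv_rel) (faeval phi)).
  exact: alift_hom.
exists (alift (faeval phi)); split.
  split=> //; apply/funext => m /=.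
  by rewrite /j (aliftE hphi.1 kill); apply: faevalE.
move=> psi [hpsi psij]; apply/funext => x; have [y <-] := qproj_surj x.
rewrite -/(aproj _ _) (aliftE hphi.1 kill).
have : psi \o aproj (gen_ideal fiv_rel) = faeval phi.
  apply: faeval_uniq => [|m]; first exact: alg_hom_comp hpsi.
  by rewrite -psij.
by move/(congr1 (@^~ y)).
Qed.

End Existence.

Section Universal.
Variables (M : lmodType K) (F : free_in_variety M).

Definition fiv_lift (B : naAlgType K) (VB : in_variety B) (phi : M -> B)
    (lphi : linear phi) : F -> B :=
  projT1 (cid (fiv_universal F VB lphi)).

Arguments fiv_lift {B} VB {phi} lphi _.

Lemma fiv_lift_hom B VB phi lphi : alg_hom (@fiv_lift B VB phi lphi).
Proof. by rewrite /fiv_lift; case: cid => psi [[]]. Qed.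

Lemma fiv_liftE B VB phi lphi m : @fiv_lift B VB phi lphi (fiv_j F m) = phi m.
Proof.
rewrite /fiv_lift; case: cid => psi [[_ e] _] /=.
exact: (congr1 (@^~ m) e).
Qed.

Lemma fiv_ext (B : naAlgType K) (f g : F -> B) : in_variety B ->
  alg_hom f -> alg_hom g -> (forall m, f (fiv_j F m) = g (fiv_j F m)) -> f = g.
Proof.
move=> VB hf hg fg.
have lg := linear_comp' (fiv_j_linear F) hg.1.
have [psi [_ uniq]] := fiv_universal F VB lg.
rewrite -(uniq f) ?(uniq g) //; split=> //.
by apply/funext => m /=; apply: fg.
Qed.

End Universal.
End Variety.

Arguments fiv_variety {K I M} f _ _ _ : rename.
Arguments fiv_j_linear {K I M} f _ _ _ : rename.
Arguments fiv_lift {K I M} F {B} VB {phi} lphi _.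

Section PartialActions.
Variables (K : comPzRingType) (G : groupType).
Implicit Types A B C : naAlgType K.

(* [pact g] is a total function, of which only the restriction to           *)
(* [pdom g^-1] is meaningful.                                               *)
Record gpaction A := GPAction {
  pdom : G -> set A;
  pact : G -> A -> A;
  pdom_subalg : forall g, is_subalg (pdom g);
  pact_linear : forall g (k : K) x y, pdom g^-1%g x -> pdom g^-1%g y ->
    pact g (k *: x + y) = k *: pact g x + pact g y;
  pact_mul : forall g x y, pdom g^-1%g x -> pdom g^-1%g y ->
    pact g (x ** y) = pact g x ** pact g y;
  pact_bij : forall g, set_bij (pdom g^-1%g) (pdom g) (pact g);
  pdom1 : pdom 1%g = setT;
  pact1 : forall x, pact 1%g x = x;
  pact_cap : forall g h,
    pact g @` (pdom g^-1%g `&` pdom (g^-1 * h)%g) `<=` pdom g `&` pdom h;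
  pact_comp : forall g h x, pdom h^-1%g x -> pdom (h^-1 * g^-1)%g x ->
    pact g (pact h x) = pact (g * h)%g x }.

Record global_action A := GlobalAction {
  gact :> gpaction A;
  gact_global : forall g, pdom gact g = setT }.

Section BuildGlobal.
Variables (B : naAlgType K) (f : G -> B -> B).
Hypotheses (fhom : forall g, alg_hom (f g)) (f1 : forall x, f 1%g x = x)
  (fM : forall g h x, f g (f h x) = f (g * h)%g x).

Lemma build_bij g : set_bij [set: B] [set: B] (f g).
Proof.
split=> [//|x y _ _ /(congr1 (f g^-1%g))|y _].
  by rewrite !fM mulVg !f1.
by exists (f g^-1%g y) => //; rewrite fM mulgV f1.
Qed.

Lemma build_linear g (k : K) x y : [set: B] x -> [set: B] y ->
  f g (k *: x + y) = k *: f g x + f g y.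
Proof. by move=> _ _; have [l _] := fhom g; apply: l. Qed.

Lemma build_mul g x y : [set: B] x -> [set: B] y ->
  f g (x ** y) = f g x ** f g y.
Proof. by move=> _ _; have [_ m] := fhom g; apply: m. Qed.

Definition build_gpaction : gpaction B :=
  @GPAction B (fun=> setT) f (fun=> subalgT B) build_linear build_mul build_bij
    erefl f1 (fun _ _ _ _ => conj I I) (fun g h x _ _ => fM g h x).

Definition build_global : global_action B :=
  @GlobalAction B build_gpaction (fun=> erefl).
End BuildGlobal.

Section Morphisms.
Variables (A B : naAlgType K) (alpha : gpaction A) (beta : gpaction B).

Definition equivariant (phi : A -> B) : Prop :=
  [/\ alg_hom phi,
      forall g, phi @` pdom alpha g `<=` pdom beta g
    & forall g x, pdom alpha g^-1%g x ->
        phi (pact alpha g x) = pact beta g (phi x)].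

End Morphisms.

Definition gp_isom A B (alpha : gpaction A) (beta : gpaction B)
    (phi : A -> B) : Prop :=
  equivariant alpha beta phi /\
  exists psi : B -> A,
    [/\ cancel phi psi, cancel psi phi & equivariant beta alpha psi].

Section Restriction.
Variables (B : naAlgType K) (beta : global_action B) (C : subalg B).

Definition restr_dom (g : G) : set (subalg_type C) :=
  [set x | (pact beta g @` subalg_set C) (sval x)].

(* The default value of insubd is never used on [restr_dom g^-1]: see       *)
(* restr_actE.                                                              *)
Definition restr_act (g : G) (x : subalg_type C) : subalg_type C :=
  insubd x (pact beta g (sval x)).

Let dT g x : pdom beta g x. Proof. by rewrite gact_global. Qed.

Let bM g h x : pact beta g (pact beta h x) = pact beta (g * h)%g x.
Proof. by apply: pact_comp; apply: dT. Qed.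

Let bK g : cancel (pact beta g) (pact beta g^-1%g).
Proof. by move=> x; rewrite bM mulVg pact1. Qed.

Let bVK g : cancel (pact beta g^-1%g) (pact beta g).
Proof. by move=> x; rewrite bM mulgV pact1. Qed.

Let blin g : linear (pact beta g).
Proof. by move=> k x y; apply: pact_linear; apply: dT. Qed.

Let bmul g x y : pact beta g (x ** y) = pact beta g x ** pact beta g y.
Proof. by apply: pact_mul; apply: dT. Qed.

Let CP (x : subalg_type C) : subalg_set C (sval x).
Proof. exact: set_mem (svalP x). Qed.

Lemma restr_domE g x :
  restr_dom g x <-> subalg_set C (pact beta g^-1%g (sval x)).
Proof.
split=> [[c Cc <-]|Cx]; first by rewrite bK.
by exists (pact beta g^-1%g (sval x)); rewrite ?bVK.
Qed.

Lemma restr_actE g x : restr_dom g^-1%g x ->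
  sval (restr_act g x) = pact beta g (sval x).
Proof.
move=> /restr_domE; rewrite invgK => Cx.
by rewrite /restr_act -[sval _]/(val _) insubdK //; apply/mem_set.
Qed.

Lemma restr_dom_act g x : restr_dom g^-1%g x -> restr_dom g (restr_act g x).
Proof.
by move=> dx; apply/restr_domE; rewrite restr_actE // bK; apply: CP.
Qed.

Lemma restr_subalg g : is_subalg (restr_dom g).
Proof.
have [[C0 Clin] Cmul] := subalgP C.
split; first split.
- by apply/restr_domE; rewrite /= (linear0' (blin _)).
- move=> k x y /restr_domE dx /restr_domE dy; apply/restr_domE.
  by rewrite /= blin; apply: Clin.
- move=> x y /restr_domE dx /restr_domE dy; apply/restr_domE.
  by rewrite /= bmul; apply: Cmul.
Qed.

Lemma restr_linear g (k : K) x y : restr_dom g^-1%g x -> restr_dom g^-1%g y ->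
  restr_act g (k *: x + y) = k *: restr_act g x + restr_act g y.
Proof.
move=> dx dy; apply: val_inj; rewrite /= !restr_actE ?blin //.
exact: (restr_subalg _).1.2.
Qed.

Lemma restr_mul g x y : restr_dom g^-1%g x -> restr_dom g^-1%g y ->
  restr_act g (x ** y) = restr_act g x ** restr_act g y.
Proof.
move=> dx dy; apply: val_inj; rewrite /= !restr_actE ?bmul //.
exact: (restr_subalg _).2.
Qed.

Lemma restr_bij g : set_bij (restr_dom g^-1%g) (restr_dom g) (restr_act g).
Proof.
split.
- by move=> x dx; apply: restr_dom_act.
- move=> x y /set_mem dx /set_mem dy /(congr1 sval).
  rewrite !restr_actE // => /(congr1 (pact beta g^-1%g)).
  by rewrite !bK => /val_inj.
- move=> y [c Cc cy]; exists (exist _ c (mem_set Cc)).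
    by apply/restr_domE; rewrite invgK /= cy; apply: CP.
  apply: val_inj; rewrite /= restr_actE //.
  by apply/restr_domE; rewrite invgK /= cy; apply: CP.
Qed.

Lemma restr_dom1 : restr_dom 1%g = setT.
Proof.
apply/seteqP; split=> // x _; apply/restr_domE.
by rewrite invg1 pact1; apply: CP.
Qed.

Lemma restr_act1 x : restr_act 1%g x = x.
Proof.
apply: val_inj; rewrite /= restr_actE ?pact1 //.
by apply/restr_domE; rewrite !invg1 pact1; apply: CP.
Qed.

Lemma restr_cap g h :
  restr_act g @` (restr_dom g^-1%g `&` restr_dom (g^-1 * h)%g)
    `<=` restr_dom g `&` restr_dom h.
Proof.
move=> _ [x [dx dx'] <-]; split; first exact: restr_dom_act.
apply/restr_domE; rewrite restr_actE // bM.
by move/restr_domE: dx'; rewrite invgM invgK.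
Qed.

Lemma restr_comp g h x : restr_dom h^-1%g x -> restr_dom (h^-1 * g^-1)%g x ->
  restr_act g (restr_act h x) = restr_act (g * h)%g x.
Proof.
move=> dx dx'; apply: val_inj; rewrite /= !restr_actE ?bM //.
  by rewrite invgM.
apply/restr_domE; rewrite invgK restr_actE // bM.
by move/restr_domE: dx'; rewrite invgM !invgK.
Qed.

Definition restriction : gpaction (subalg_type C) :=
  GPAction restr_subalg restr_linear restr_mul restr_bij restr_dom1 restr_act1
    restr_cap restr_comp.

End Restriction.

Section Globalization.
Variables (I : set (freealg K nat)) (A : naAlgType K) (alpha : gpaction A).

Definition is_globalization B (theta : global_action B) (nu : A -> B) : Prop :=
  [/\ in_variety I B,
      equivariant alpha theta nu,
      exists hnu : alg_hom nu,
        gp_isom alpha (restriction theta (im_subalg hnu)) (corestr hnu)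
    & gen_subalg (\bigcup_(g : G) (pact theta g @` range nu)) = setT].

Definition globalizable : Prop :=
  exists (B : naAlgType K) (theta : global_action B) (nu : A -> B),
    is_globalization theta nu.

Definition Lambda_rel : set (tensor (freemod K G) A) :=
  [set r | exists (g h : G) (a : A), pdom alpha h^-1%g a /\
     r = tens (fmgen K g) (pact alpha h a) - tens (fmgen K (g * h)%g) a].

Definition Lambda : lmodType K := quotmod (submod_span Lambda_rel).

Definition Lcls (g : G) (a : A) : Lambda :=
  qproj (submod_span Lambda_rel) (tens (fmgen K g) a).

(* Left translation by g on KG, tensored with A. *)
Definition translate (g : G) : tensor (freemod K G) A -> tensor (freemod K G) A :=
  tlift (fun u a => tens (fmlift (fun h => fmgen K (g * h)%g) u) a).

Lemma translate_linear g : linear (translate g).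
Proof.
apply: tlift_linear => [a|u]; last exact: tens_linearr.
exact: (linear_comp' (@fmlift_linear _ _ _ _) (tens_linearl a)).
Qed.

Lemma translateE g h a :
  translate g (tens (fmgen K h) a) = tens (fmgen K (g * h)%g) a.
Proof.
rewrite /translate tliftE ?fmliftE // => [b|u]; last exact: tens_linearr.
exact: (linear_comp' (@fmlift_linear _ _ _ _) (tens_linearl b)).
Qed.

Definition Theta (g : G) : Lambda -> Lambda :=
  qlift (S := submod_span Lambda_rel) (qproj (submod_span Lambda_rel) \o translate g).

Lemma Theta_kill g x :
  submod_span Lambda_rel x -> (qproj (submod_span Lambda_rel) \o translate g) x = 0.
Proof.
have L := linear_comp' (translate_linear g) (@qproj_linear _ _ (submod_span Lambda_rel)).
apply: (span_kill L) => {x} _ [h [k [a [da ->]]]] /=.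
rewrite (linearB' (translate_linear g)) !translateE.
rewrite -(linear0' (@qproj_linear _ _ (submod_span Lambda_rel))).
apply: qproj_span; rewrite subr0.
by exists (g * h)%g, k, a; rewrite mulgA.
Qed.

Lemma Theta_linear g : linear (Theta g).
Proof.
apply: (qlift_linear _ (@Theta_kill g)).
exact: (linear_comp' (translate_linear g) (@qproj_linear _ _ _)).
Qed.

Lemma ThetaE g h a : Theta g (Lcls h a) = Lcls (g * h)%g a.
Proof.
rewrite /Theta /Lcls (qliftE _ (@Theta_kill g)) /= ?translateE //.
exact: (linear_comp' (translate_linear g) (@qproj_linear _ _ _)).
Qed.

Lemma Lambda_ext (V : lmodType K) (f1 f2 : Lambda -> V) :
  linear f1 -> linear f2 ->
  (forall g a, f1 (Lcls g a) = f2 (Lcls g a)) -> f1 = f2.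
Proof.
move=> l1 l2 e; apply/funext => x; have [t <-] := qproj_surj x.
have L := @qproj_linear _ _ (submod_span Lambda_rel).
suff : f1 \o qproj (submod_span Lambda_rel) = f2 \o qproj (submod_span Lambda_rel).
  by move/(congr1 (@^~ t)).
apply: tensor_ext; try exact: linear_comp'; move=> u a.
have k1 := linear_comp' (tens_linearl a) (linear_comp' L l1).
have k2 := linear_comp' (tens_linearl a) (linear_comp' L l2).
apply: (congr1 (@^~ u) (freemod_ext k1 k2 _)) => g.
exact: e.
Qed.

Lemma Theta1 x : Theta 1%g x = x.
Proof.
apply: (congr1 (@^~ x) (Lambda_ext (Theta_linear _) (f2 := fun x => x) _ _)) => //.
by move=> g a; rewrite ThetaE mul1g.
Qed.

Lemma ThetaM g h x : Theta g (Theta h x) = Theta (g * h)%g x.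
Proof.
apply: (congr1 (@^~ x) (Lambda_ext (f1 := Theta g \o Theta h) _ _ _)).
- by apply: linear_comp'; apply: Theta_linear.
- exact: Theta_linear.
- by move=> k a; rewrite /= !ThetaE mulgA.
Qed.

Definition Liota (a : A) : Lambda := Lcls 1%g a.

(* F plays the role of F_I(Lambda(A)).                                      *)

Variable F : free_in_variety I Lambda.
Local Notation j := (fiv_j F).

Definition tTheta (g : G) : F -> F :=
  fiv_lift F (fiv_variety F) (linear_comp' (Theta_linear g) (fiv_j_linear F)).

Lemma tTheta_hom g : alg_hom (tTheta g).
Proof. exact: fiv_lift_hom. Qed.

Lemma tThetaE g x : tTheta g (j x) = j (Theta g x).
Proof. exact: fiv_liftE. Qed.

Lemma tTheta1 x : tTheta 1%g x = x.
Proof.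
apply: (congr1 (@^~ x) (fiv_ext (fiv_variety F) (tTheta_hom 1%g)
  (alg_hom_id F) _)) => m.
by rewrite tThetaE Theta1.
Qed.

Lemma tThetaM g h x : tTheta g (tTheta h x) = tTheta (g * h)%g x.
Proof.
apply: (congr1 (@^~ x) (fiv_ext (fiv_variety F)
  (alg_hom_comp (tTheta_hom h) (tTheta_hom g)) (tTheta_hom _) _)) => m /=.
by rewrite !tThetaE ThetaM.
Qed.

Definition tTheta_action : global_action F :=
  build_global tTheta_hom tTheta1 tThetaM.

Definition Omega_rel : set F :=
  [set r | exists (g : G) (a b : A),
     r = j (Lcls g a) ** j (Lcls g b) - j (Lcls g (a ** b))].

Definition Omega_ideal : ideal F := gen_ideal Omega_rel.

Definition Omega : naAlgType K := quotalg Omega_ideal.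

Definition Omega_p : F -> Omega := aproj Omega_ideal.

Definition theta (g : G) : Omega -> Omega :=
  alift (J := Omega_ideal) (Omega_p \o pact tTheta_action g).

Let pT_hom g : alg_hom (Omega_p \o pact tTheta_action g).
Proof. exact: alg_hom_comp (tTheta_hom g) (aproj_hom _). Qed.

Lemma theta_kill g x : Omega_ideal x -> (Omega_p \o pact tTheta_action g) x = 0.
Proof.
apply: (gen_ideal_kill (pT_hom g)) => {x} _ [h [a [b ->]]] /=.
rewrite (linearB' (tTheta_hom g).1) (tTheta_hom g).2 !tThetaE !ThetaE.
rewrite -(linear0' (aproj_hom Omega_ideal).1).
apply: aproj_gen; rewrite subr0.
by exists (g * h)%g, a, b.
Qed.

Lemma theta_hom g : alg_hom (theta g).
Proof. exact: alift_hom (pT_hom g) (@theta_kill g). Qed.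

Lemma thetaE g x : theta g (Omega_p x) = Omega_p (pact tTheta_action g x).
Proof. by rewrite /theta (aliftE (pT_hom g).1 (@theta_kill g)). Qed.

Lemma theta1 x : theta 1%g x = x.
Proof.
have [y <-] := qproj_surj x.
by rewrite -[qproj _ _]/(Omega_p y) thetaE /= tTheta1.
Qed.

Lemma thetaM g h x : theta g (theta h x) = theta (g * h)%g x.
Proof.
have [y <-] := qproj_surj x.
by rewrite -[qproj _ _]/(Omega_p y) !thetaE /= tThetaM.
Qed.

Definition theta_action : global_action Omega :=
  build_global theta_hom theta1 thetaM.

Definition nu : A -> Omega := Omega_p \o j \o Liota.

End Globalization.
End PartialActions.

Arguments theta {K G I A alpha} F g x.
Arguments tTheta {K G I A alpha} F g x.
Arguments Omega_p {K G I A alpha} F x.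

(* Main.v *)
Require Import Defs.
From mathcomp Require Import all_boot all_algebra.
From mathcomp Require Import boolp classical_sets.

(** The pair [(theta, nu)] is the universal candidate for a globalization: for
    every algebra B of the variety with a global action beta and every
    equivariant mu : A -> B, the assignment [|_g, a_| |-> beta_g (mu a)]
    respects the relations that define [Lambda] (equivariance of mu) and
    [Omega] (multiplicativity of mu), so it induces an algebra homomorphism
    f : Omega -> B with [f (theta_g (nu a)) = beta_g (mu a)]
    ([Omega_lift_exists]).

    An equivariant map into a global action identifies alpha with the
    restriction to its image exactly when it is injective and the only
    coincidences [mu a = beta_g (mu b)] are those with a in the domain [A_g]
    ([gp_isom_corestrP]). Both conditions pull back along f: an equality
    between [nu a] and [nu b], or [nu a] and [theta_g (nu b)], is sent by f to
    the same equality for mu. Hence if any globalization (beta, mu) exists, nu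
    satisfies them too.

    The rest holds without assuming that alpha is globalizable: [Omega] is a
    quotient of an algebra of the variety; nu is equivariant because the
    relations impose it; and the translates of the image of nu generate
    [Omega], since the classes [|_g, a_|] span [Lambda], while [F_I(M)] is
    generated by M ([fiv_generated]). *)

Set Implicit Arguments.
Unset Strict Implicit.
Unset Printing Implicit Defensive.

Import GRing.Theory.
Local Open Scope ring_scope.
Local Open Scope classical_set_scope.

(** * Varieties and free algebras *)

Section Varieties.
Variables (K : comPzRingType) (I : set (freealg K nat)).

Lemma in_variety_quotalg (A : naAlgType K) (J : ideal A) :
  in_variety I A -> in_variety I (quotalg J).
Proof.
move=> VA; apply: quotalg_variety => v f If.
by rewrite VA //; apply: (idealP J).1.1.
Qed.

Lemma in_variety_subalg (A : naAlgType K) (S : subalg A) :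
  in_variety I A -> in_variety I (subalg_type S).
Proof.
move=> VA v f If; apply: val_inj => /=.
by rewrite -[LHS]/((sval \o faeval v) f) (faeval_comp v (val_hom S)) VA.
Qed.

(** A subalgebra S containing [j M] lies in the variety, so j lifts to a
    homomorphism F -> S; composed with the inclusion it fixes [j M], hence it
    is the identity of F. *)
Lemma fiv_generated (M : lmodType K) (F : free_in_variety I M) (S : set F) :
  is_subalg S -> (forall m, S (fiv_j F m)) -> forall x, S x.
Proof.
move=> SP Sj x; pose T := Subalg SP.
pose k m : subalg_type T := exist _ (fiv_j F m) (mem_set (Sj m)).
have lk : linear k by move=> c m n; apply: val_inj; apply: fiv_j_linear.
have VT : in_variety I (subalg_type T) := in_variety_subalg (fiv_variety F).
pose r := fiv_lift F VT lk.
have hr : alg_hom (sval \o r : F -> F).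
  exact: alg_hom_comp (fiv_lift_hom F VT lk) (val_hom T).
have rid : sval \o r = id :> (F -> F).
  apply: (fiv_ext (fiv_variety F) hr (alg_hom_id F)) => m.
  by rewrite /= /r fiv_liftE.
by rewrite -[x]/(id x) -rid /=; apply: set_mem (svalP (r x)).
Qed.

Lemma preim_subalg (A B : naAlgType K) (f : A -> B) (S : set B) :
  alg_hom f -> is_subalg S -> is_subalg (f @^-1` S).
Proof.
move=> [lf mf] [Ssub Smul]; split; first exact: preim_submod.
by move=> x y Sx Sy; rewrite /= mf; apply: Smul.
Qed.

End Varieties.

(** * Equivariant maps into global actions *)

Section EquivariantMaps.
Variables (K : comPzRingType) (G : groupType) (A B : naAlgType K).
Variables (alpha : gpaction G A) (beta : global_action G B).

Lemma gact_linear g : linear (pact beta g).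
Proof. by move=> k x y; apply: pact_linear; rewrite gact_global. Qed.

Lemma gact_mul g : {morph pact beta g : x y / x ** y}.
Proof. by move=> x y; apply: pact_mul; rewrite gact_global. Qed.

Lemma gact_comp g h x : pact beta g (pact beta h x) = pact beta (g * h)%g x.
Proof. by apply: pact_comp; rewrite gact_global. Qed.

Variable mu : A -> B.
Hypothesis emu : equivariant alpha beta mu.

Lemma equivariant_dom g a : pdom alpha g a ->
  exists b, mu a = pact beta g (mu b).
Proof.
have [_ _ ec] := emu; have [_ _ sj] := pact_bij alpha g.
by move=> /sj [b db <-]; exists b; rewrite ec.
Qed.

(** The domain [A_g] always maps into [mu A `&` beta_g (mu A)], and the actions
    always agree there; only injectivity and the reverse inclusion of domains
    are at stake. *)
Lemma gp_isom_corestrP (hmu : alg_hom mu) :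
  gp_isom alpha (restriction beta (im_subalg hmu)) (corestr hmu) <->
  (injective mu /\
   forall g a b, mu a = pact beta g (mu b) -> pdom alpha g a).
Proof.
have [_ _ ec] := emu.
have corestr_dom g a : pdom alpha g a ->
    restr_dom beta g (corestr hmu a).
  by move=> /equivariant_dom [b ab]; exists (mu b); [exists b | rewrite -ab].
have corestr_act g a : pdom alpha g^-1%g a ->
    corestr hmu (pact alpha g a) = restr_act beta g (corestr hmu a).
  move=> da; apply: val_inj; apply: etrans (ec g a da) _.
  exact/esym/restr_actE/corestr_dom.
split=> [[_ [psi [muK _ [_ psid _]]]]|[inj doms]].
  split=> [a b ab|g a b ab].
    by apply: (can_inj muK); apply: val_inj.
  rewrite -[a]muK; apply: psid; exists (corestr hmu a) => //.
  by exists (mu b) => //; exists b.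
have ch : alg_hom (corestr hmu).
  split=> [k x y|x y]; apply: val_inj => /=; first exact: hmu.1.
  exact: hmu.2.
split; first by split=> // g _ [a da <-]; apply: corestr_dom.
have surj (y : subalg_type (im_subalg hmu)) : exists a, corestr hmu a = y.
  case: y => y yP; have [a _ ay] := set_mem yP.
  by exists a; apply: val_inj.
have [psi psiK] := choice surj.
have cinj : injective (corestr hmu) by move=> a b /(congr1 sval) /inj.
have psi_dom g y : restr_dom beta g y -> pdom alpha g (psi y).
  case=> _ [b _ <-] by_; apply: (doms g _ b).
  by rewrite by_ -{2}(psiK y).
exists psi; split=> [a| |]; [exact: cinj | exact: psiK | split].
- split=> [k x y|x y]; apply: cinj; first by rewrite ch.1 !psiK.
  by rewrite ch.2 !psiK.
- by move=> g _ [y dy <-]; apply: psi_dom.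
- move=> g y dy; apply: cinj.
  by rewrite psiK corestr_act ?psiK //; apply: psi_dom.
Qed.

End EquivariantMaps.

(** * The module Lambda *)

Section LambdaTheory.
Variables (K : comPzRingType) (G : groupType) (A : naAlgType K).
Variable alpha : gpaction G A.

Lemma Lcls_linear g : linear (Lcls alpha g).
Proof. exact: (linear_comp' (tens_linearr _) (@qproj_linear _ _ _)). Qed.

Lemma Lcls_pact g h a : pdom alpha h^-1%g a ->
  Lcls alpha g (pact alpha h a) = Lcls alpha (g * h)%g a.
Proof. by move=> da; apply: qproj_span; exists g, h, a. Qed.

(** The projection onto [Lambda / P] and the zero map agree on the classes
    [|_g, a_|]. *)
Lemma Lambda_spanned (P : set (Lambda alpha)) :
  is_submod P -> (forall g a, P (Lcls alpha g a)) -> forall x, P x.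
Proof.
move=> PP PL x; pose S := Submodule PP.
have /(congr1 (@^~ x)) Sx : qproj S = (fun=> 0).
  apply: Lambda_ext => [|k u v|g a]; first exact: qproj_linear.
    by rewrite scaler0 addr0.
  rewrite -(linear0' (@qproj_linear _ _ S)).
  by apply/qproj_eq; rewrite subr0; apply: PL.
have : S (x - 0) by apply/qproj_eq; rewrite Sx (linear0' (@qproj_linear _ _ S)).
by rewrite subr0.
Qed.

Lemma Lambda_lift_exists (V : lmodType K) (phi : G -> A -> V) :
  (forall g, linear (phi g)) ->
  (forall g h a, pdom alpha h^-1%g a ->
     phi g (pact alpha h a) = phi (g * h)%g a) ->
  exists2 f : Lambda alpha -> V,
    linear f & forall g a, f (Lcls alpha g a) = phi g a.
Proof.
move=> lphi phiM; pose t := tlift (fun u a => fmlift (phi^~ a) u).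
have tl1 a : linear (fun u => fmlift (phi^~ a) u) by apply: fmlift_linear.
have tl2 u : linear (fun a => fmlift (phi^~ a) u).
  exact: (fmlift_param_linear u lphi).
have lt : linear t := tlift_linear tl1 tl2.
have tE g a : t (tens (fmgen K g) a) = phi g a.
  by rewrite /t tliftE // fmliftE.
have kill : forall x, submod_span (@Lambda_rel _ _ _ alpha) x -> t x = 0.
  apply: (span_kill lt) => _ [g [h [a [da ->]]]].
  by rewrite (linearB' lt) !tE phiM // subrr.
exists (qlift t); first exact: qlift_linear.
by move=> g a; rewrite /Lcls qliftE // tE.
Qed.

End LambdaTheory.

(** * The algebra Omega *)

Section OmegaTheory.
Variables (K : comPzRingType) (G : groupType) (I : set (freealg K nat)).
Variables (A : naAlgType K) (alpha : gpaction G A).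
Variable F : free_in_variety I (Lambda alpha).

Lemma in_variety_Omega : in_variety I (Omega F).
Proof. exact: in_variety_quotalg (fiv_variety F). Qed.

Lemma Omega_p_hom : alg_hom (Omega_p F).
Proof. exact: aproj_hom. Qed.

Lemma theta_nu g a : theta F g (nu F a) = Omega_p F (fiv_j F (Lcls alpha g a)).
Proof. by rewrite thetaE /= tThetaE ThetaE mulg1. Qed.

Lemma nu_hom : alg_hom (nu F).
Proof.
split=> [k a b|a b].
  by rewrite /nu /= /Liota Lcls_linear (fiv_j_linear F) Omega_p_hom.1.
rewrite /nu /= -Omega_p_hom.2; apply/esym/aproj_gen.
by exists 1%g, a, b.
Qed.

Lemma nu_pact g a : pdom alpha g^-1%g a ->
  nu F (pact alpha g a) = theta F g (nu F a).
Proof. by move=> da; rewrite theta_nu /nu /= /Liota Lcls_pact // mul1g. Qed.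

Lemma nu_equivariant : equivariant alpha (theta_action F) (nu F).
Proof. by split=> [|//|g a]; [exact: nu_hom | exact: nu_pact]. Qed.

Lemma Omega_generated :
  gen_subalg (\bigcup_(g : G) (pact (theta_action F) g @` range (nu F))) = setT.
Proof.
apply/seteqP; split=> // x _ S [SP SE].
have [y <-] := qproj_surj x.
apply: (fiv_generated (preim_subalg Omega_p_hom SP)) => m /=.
have PP : is_submod ((Omega_p F \o fiv_j F) @^-1` S).
  apply: preim_submod SP.1.
  exact: linear_comp' (fiv_j_linear F) Omega_p_hom.1.
apply: (Lambda_spanned PP) => g a /=.
rewrite -theta_nu; apply: SE; exists g => //.
by exists (nu F a) => //; exists a.
Qed.

(** The existence half of the universal property of [Omega] among the algebras
    of the variety that carry a global action and an equivariant map from A: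
    equivariance of mu kills the relations of [Lambda], multiplicativity of
    [beta_g \o mu] those of [Omega]. *)
Lemma Omega_lift_exists (B : naAlgType K) (beta : global_action G B)
    (mu : A -> B) : in_variety I B -> equivariant alpha beta mu ->
  exists2 f : Omega F -> B,
    alg_hom f & forall g a, f (theta F g (nu F a)) = pact beta g (mu a).
Proof.
move=> VB [[lmu mmu] _ ec].
have lphi g : linear (fun a => pact beta g (mu a)).
  exact: linear_comp' lmu (gact_linear _ _).
have phiM g h a : pdom alpha h^-1%g a ->
    pact beta g (mu (pact alpha h a)) = pact beta (g * h)%g (mu a).
  by move=> da; rewrite ec // gact_comp.
have [f lf fE] := Lambda_lift_exists lphi phiM.
have hF := fiv_lift_hom F VB lf.
have FE g a : fiv_lift F VB lf (fiv_j F (Lcls alpha g a)) = pact beta g (mu a).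
  by rewrite fiv_liftE fE.
have kill : forall x, Omega_ideal F x -> fiv_lift F VB lf x = 0.
  apply: (gen_ideal_kill hF) => _ [g [a [b ->]]].
  by rewrite (linearB' hF.1) hF.2 !FE mmu gact_mul subrr.
exists (alift (fiv_lift F VB lf)) => [|g a]; first exact: alift_hom.
by rewrite theta_nu aliftE ?FE //; apply: hF.1.
Qed.

End OmegaTheory.

(** * Transfer from an arbitrary globalization *)

Theorem corollary2p14 (K : comPzRingType) (G : groupType)
    (I : set (freealg K nat)) (A : naAlgType K) (hA : in_variety I A)
    (alpha : gpaction G A) (F : free_in_variety I (Lambda alpha)) :
  globalizable I alpha -> is_globalization I alpha (theta_action F) (nu F).
Proof.
move=> [B [beta [mu [VB emu [hmu /(gp_isom_corestrP emu) [mu_inj mu_dom]] _]]]].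
have [f _ fE] := Omega_lift_exists F VB emu.
have f_nu a : f (nu F a) = mu a.
  by rewrite -(theta1 (nu F a)) fE pact1.
split; [exact: in_variety_Omega | exact: nu_equivariant | | ].
  exists (nu_hom F); apply/(gp_isom_corestrP (nu_equivariant F)).
  split=> [a b ab|g a b ab]; first by apply: mu_inj; rewrite -!f_nu ab.
  by apply: (mu_dom g a b); rewrite -f_nu -fE ab.
exact: Omega_generated.
Qed.
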